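(* Let $\Phi$ be an irreducible simply laced root system with simple roots $\{\alpha_i\mid i\in I\}$, Cartan matrix $A=(a_{ij})_{i,j\in I}$ and root lattice $Q=\mathbb{Z}\Phi$, and let $\langle\;,\;\rangle$ be normalised such that $\langle\alpha,\alpha\rangle=2$ for all $\alpha\in\Phi$. Let $\{c_i\mid i\in I\}$ be a collection of signs $c_i\in\{\pm1\}$ such that $c_i=-c_j$ whenever $i\neq j$ and $a_{ij}\neq0$. Let $\varepsilon_0\colon Q\times Q\to\{\pm1\}$ be the function defined, for $\alpha=\sum_{i\in I}n_i\alpha_i$ and $\beta=\sum_{j\in I}m_j\alpha_j$ with $n_i,m_j\in\mathbb{Z}$, by $$\varepsilon_0(\alpha,\beta)=\prod_{i,j\in I}c_i^{a_{ij}n_im_j}.$$ Then $\varepsilon_0$ satisfies, for all $\alpha,\beta,\gamma\in Q$: (FLM1) $\varepsilon_0(\alpha,\beta)\varepsilon_0(\alpha+\beta,\gamma)=\varepsilon_0(\beta,\gamma)\varepsilon_0(\alpha,\beta+\gamma)$; (FLM2) $\varepsilon_0(\alpha,0)=\varepsilon_0(0,\alpha)=1$; (FLM3) $\varepsilon_0(\alpha,\beta)\varepsilon_0(\beta,\alpha)=(-1)^{\langle\alpha,\beta\rangle}$. Hence the algebra $\mathfrak{g}=\mathfrak{g}(\varepsilon_0)$ attached to $\varepsilon_0$ (defined in the context) is a simple Lie algebra over $\mathbb{C}$. The collection $\mathcal{L}=\{e_\alpha\mid\alpha\in\Phi\}$ is a special Chevalley system for $\mathfrak{g}$, where the corresponding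 signs are exactly the given signs $\{c_i\mid i\in I\}$. Furthermore, $$\varepsilon_0(\alpha,\alpha)=\varepsilon_0(\alpha,-\alpha)=-(-1)^{\operatorname{ht}(\alpha)}\qquad\text{for all }\alpha\in\Phi.$$
   Context: Let $E$ be a finite-dimensional real vector space with positive-definite scalar product $\langle\;,\;\rangle$, and $\Phi\subseteq E$ an irreducible crystallographic (reduced) root system spanning $E$, with a fixed system of simple roots $\{\alpha_i\mid i\in I\}$, positive roots $\Phi^+$ and negative roots $\Phi^-$. Cartan matrix: $a_{ij}=2\langle\alpha_i,\alpha_j\rangle/\langle\alpha_i,\alpha_i\rangle$. ''Simply laced'' means that $A$ is symmetric; then all roots have the same length, and with the normalisation $\langle\alpha,\alpha\rangle=2$ one has $a_{ij}=\langle\alpha_i,\alpha_j\rangle$. The height of $\alpha=\sum_i n_i\alpha_i$ is $\operatorname{ht}(\alpha)=\sum_i n_i$. The algebra $\mathfrak{g}(\varepsilon)$: for a function $\varepsilon\colon Q\times Q\to\{\pm1\}$, let $\mathfrak{g}$ be the complex vector space with basis $\{h_i\mid i\in I\}\cup\{e_\alpha\mid\alpha\in\Phi\}$, let $\mathfrak{h}=\langle h_i\mid i\in I\rangle_{\mathbb{C}}$, and for $\alpha=\sum_i n_i\alpha_i\in\Phi$ put $h_\alpha=\sum_i n_ih_i$. Define a bilinear product $[\;,\;]\colon\mathfrak{g}\times\mathfrak{g}\to\mathfrak{g}$ by: $[h_i,h_j]=0$; $[h_i,e_\alpha]=-[e_\alpha,h_i]=\langle\alpha_i,\alpha\rangle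 e_\alpha$; $[e_\alpha,e_{-\alpha}]=\varepsilon(\alpha,-\alpha)h_\alpha$; $[e_\alpha,e_\beta]=0$ if $\alpha+\beta\notin\Phi\cup\{0\}$; $[e_\alpha,e_\beta]=\varepsilon(\alpha,\beta)e_{\alpha+\beta}$ if $\alpha+\beta\in\Phi$. (When $\mathfrak g$ is a Lie algebra, $\mathfrak h$ is taken as Cartan subalgebra, the root space of $\alpha\in\Phi$ is $\mathfrak{g}_\alpha=\mathbb{C}e_\alpha$, and $h_\alpha$ is the co-root of $\alpha$.) For $\alpha,\beta\in\Phi$ put $p_{\alpha,\beta}=\max\{m\geq0\mid\beta+m\alpha\in\Phi\}$ and $q_{\alpha,\beta}=\max\{m\geq0\mid\beta-m\alpha\in\Phi\}$. Let $\mathfrak{g}$ be a simple complex Lie algebra with Cartan subalgebra $\mathfrak h$, root system $\Phi$, root spaces $\mathfrak{g}_\alpha$ and co-roots $h_\alpha\in[\mathfrak{g}_\alpha,\mathfrak{g}_{-\alpha}]$ (characterised by $h_\alpha\ne 0$ and $[h_\alpha,x]=2x$ for $x\in\mathfrak{g}_\alpha$); $h_i:=h_{\alpha_i}$. A collection $\mathcal{L}=\{e_\alpha\mid\alpha\in\Phi\}$ with $0\neq e_\alpha\in\mathfrak{g}_\alpha$ is a Chevalley system if $[e_\alpha,e_\beta]=\varepsilon(\alpha,\beta)(q_{\alpha,\beta}+1)e_{\alpha+\beta}$ with $\varepsilon(\alpha,\beta)\in\{\pm1\}$ whenever $\alpha,\beta,\alpha+\beta\in\Phi$. It is a special Chevalley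 system, with corresponding signs $\{c_i\mid i\in I\}$, $c_i\in\{\pm1\}$, if moreover for each $i\in I$: $[e_{\alpha_i},e_{-\alpha_i}]=h_i$; $[e_{\alpha_i},e_\alpha]=c_i(q_{\alpha_i,\alpha}+1)e_{\alpha+\alpha_i}$ if $\alpha\in\Phi^+$ and $\alpha+\alpha_i\in\Phi$; and $[e_{-\alpha_i},e_\alpha]=c_i(p_{\alpha_i,\alpha}+1)e_{\alpha-\alpha_i}$ if $\alpha\in\Phi^-$ and $\alpha-\alpha_i\in\Phi$. *)

(* Defs.v *)
From HB Require Import structures.
From mathcomp Require Import all_boot all_order all_algebra.
From mathcomp Require Import finmap.
From mathcomp Require Import boolp classical_sets reals.
From mathcomp Require Import complex.

Set Implicit Arguments.
Unset Strict Implicit.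
Unset Printing Implicit Defensive.

Import Order.TTheory GRing.Theory Num.Theory.
Local Open Scope ring_scope.

Definition is_sign (s : int) : Prop := s = 1 \/ s = -1.

(* The largest element of a nonempty bounded set of naturals (0 if there is
   none). *)
Definition nat_max (S : set nat) : nat :=
  xget 0%N [set m | S m /\ forall k, S k -> (k <= m)%N]%classic.

Section RootSystems.
Variables (R : realType) (E : vectType R) (dot : {dot E for idfun}).
Variable Phi : {fset E}.

Definition cartan_number (a b : E) : R := 2 * dot a b / dot a a.

Record root_system : Prop := RootSystem {
  roots_span : <<Phi>>%VS = fullv;
  roots_neq0 : 0 \notin Phi;
  roots_reflection : forall a b, a \in Phi -> b \in Phi ->
    b - cartan_number a b *: a \in Phi;
  roots_crystallographic : forall a b, a \in Phi -> b \in Phi ->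
    cartan_number a b \is a Num.int;
  roots_reduced : forall a (r : R), a \in Phi -> r *: a \in Phi ->
    r = 1 \/ r = -1
}.

Definition irreducible_roots : Prop :=
  Phi != fset0 /\
  forall Psi : {fset E}, (Psi `<=` Phi)%fset ->
    (forall a b, a \in Psi -> b \in (Phi `\` Psi)%fset -> dot a b = 0) ->
    Psi = fset0 \/ Psi = Phi.

Definition root_lattice (x : E) : Prop := inIntSpan (in_tuple Phi) x.

Variables (I : finType) (alpha : I -> E).

Definition positive_root (a : E) : Prop :=
  a \in Phi /\ exists n : I -> nat, a = \sum_i alpha i *+ n i.

Definition negative_root (a : E) : Prop :=
  a \in Phi /\ exists n : I -> nat, a = - (\sum_i alpha i *+ n i).

Record simple_roots : Prop := SimpleRoots {
  simple_in : forall i, alpha i \in Phi;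
  simple_basis : basis_of {:E} [seq alpha i | i <- enum I];
  simple_pos_or_neg : forall a, a \in Phi -> positive_root a \/ negative_root a
}.

(* For simple roots of a root system the Cartan numbers are integers, so that
   Num.floor only changes their type. *)
Definition cartan_matrix (i j : I) : int :=
  Num.floor (cartan_number (alpha i) (alpha j)).

Definition simply_laced : Prop :=
  forall i j, cartan_matrix i j = cartan_matrix j i.

(* The integers n_i such that x = \sum_i n_i alpha_i, unique since the simple
   roots are free; the value 0 is used outside of the root lattice. *)
Definition coefs (x : E) : {ffun I -> int} :=
  xget [ffun=> 0] [set n : {ffun I -> int} | x = \sum_i alpha i *~ n i]%classic.

Definition height (x : E) : int := \sum_i coefs x i.

(* <a, b> as an integer exponent: the scalar product takes integral values on
   the root lattice when <a, a> = 2 for all roots a. *)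
Definition dotz (a b : E) : int := Num.floor (dot a b).

Definition eps0 (c : I -> int) (a b : E) : int :=
  \prod_i \prod_j c i ^ (cartan_matrix i j * coefs a i * coefs b j).

Definition string_p (a b : E) : nat :=
  nat_max [set m | b + a *+ m \in Phi]%classic.

Definition string_q (a b : E) : nat :=
  nat_max [set m | b - a *+ m \in Phi]%classic.


End RootSystems.

Section LieAlgebras.
Variables (K : fieldType) (L : vectType K) (br : L -> L -> L).

Record lie_algebra : Prop := LieAlgebra {
  lie_linearl : forall z, linear (br^~ z);
  lie_linearr : forall z, linear (br z);
  lie_alternating : forall x, br x x = 0;
  lie_jacobi : forall x y z,
    br x (br y z) + br y (br z x) + br z (br x y) = 0
}.

Definition lie_ideal (U : {vspace L}) : Prop :=
  forall x y, y \in U -> br x y \in U.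

Definition simple_lie_algebra : Prop :=
  [/\ lie_algebra,
      exists x y, br x y != 0 &
      forall U : {vspace L}, lie_ideal U -> U = 0%VS \/ U = fullv].

(* The span of all br x y with x in U and y in V. *)
Definition lie_prod (U V : {vspace L}) : {vspace L} :=
  <<[seq br x y | x <- vbasis U, y <- vbasis V]>>%VS.

Definition lie_subalgebra (H : {vspace L}) : Prop :=
  forall x y, x \in H -> y \in H -> br x y \in H.

Definition lie_nilpotent (H : {vspace L}) : Prop :=
  exists n, iter n (lie_prod H) H = 0%VS.

Definition cartan_subalgebra (H : {vspace L}) : Prop :=
  [/\ lie_subalgebra H, lie_nilpotent H &
      forall x, (forall h, h \in H -> br x h \in H) -> x \in H].

Variable H : {vspace L}.

(* The x such that br h x = lam h *: x for all h in H; it suffices to require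
   this for h in a basis of H. *)
Definition weight_space (lam : 'Hom(subvs_of H, K^o)) : {vspace L} :=
  (\bigcap_(h <- vbasis {:subvs_of H})
     passmx.leigenspace (linfun (br (vsval h))) (lam h))%VS.

Definition lie_root (lam : 'Hom(subvs_of H, K^o)) : Prop :=
  lam != 0 /\ weight_space lam != 0%VS.

(* Phi is abstract: wt identifies it with the set of roots with respect to H,
   which are linear forms on H. *)
Variables (E : zmodType) (Phi : {fset E}) (wt : E -> 'Hom(subvs_of H, K^o)).

Record is_root_system_of : Prop := IsRootSystemOf {
  wt_add : {morph wt : a b / a + b};
  wt_inj : {in Phi &, injective wt};
  wt_roots : forall lam, lie_root lam <-> exists2 a, a \in Phi & lam = wt a
}.

Definition are_coroots (hc : E -> L) : Prop :=
  forall a, a \in Phi ->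
    [/\ hc a \in lie_prod (weight_space (wt a)) (weight_space (wt (- a))),
        hc a != 0 &
        forall x, x \in weight_space (wt a) -> br (hc a) x = 2 *: x].

End LieAlgebras.

Section ChevalleySystems.
Variables (R : realType) (E : vectType R) (Phi : {fset E}).
Variables (I : finType) (alpha : I -> E).
Variables (L : vectType R[i]) (br : L -> L -> L) (H : {vspace L}).
Variable wt : E -> 'Hom(subvs_of H, (R[i])^o).

(* Only the values of e on Phi matter; likewise for the co-roots hc below. *)
Record chevalley_system (e : E -> L) : Prop := ChevalleySystem {
  chev_simple : simple_lie_algebra br;
  chev_cartan : cartan_subalgebra br H;
  chev_roots : is_root_system_of br Phi wt;
  chev_root_vector : forall a, a \in Phi ->
    e a \in weight_space br (wt a) /\ e a != 0;
  chev_const : forall a b, a \in Phi -> b \in Phi -> a + b \in Phi ->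
    exists2 s : int, is_sign s &
      br (e a) (e b) = (s * (string_q Phi a b).+1%:Z)%:~R *: e (a + b)
}.

Record special_chevalley_system (hc e : E -> L) (c : I -> int) : Prop :=
  SpecialChevalleySystem {
  schev_system : chevalley_system e;
  schev_coroots : are_coroots br Phi wt hc;
  schev_sign : forall i, is_sign (c i);
  schev_simple_coroot : forall i,
    br (e (alpha i)) (e (- alpha i)) = hc (alpha i);
  schev_pos : forall i a,
    positive_root Phi alpha a -> a + alpha i \in Phi ->
    br (e (alpha i)) (e a) =
      (c i * (string_q Phi (alpha i) a).+1%:Z)%:~R *: e (a + alpha i);
  schev_neg : forall i a,
    negative_root Phi alpha a -> a - alpha i \in Phi ->
    br (e (- alpha i)) (e a) =
      (c i * (string_p Phi (alpha i) a).+1%:Z)%:~R *: e (a - alpha i)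
}.

End ChevalleySystems.

Section AlgebraOfEps.
Variables (R : realType) (E : vectType R) (dot : {dot E for idfun}).
Variables (Phi : {fset E}) (I : finType) (alpha : I -> E).
Local Open Scope complex_scope.

(* Coordinates with respect to the basis (h_i)_i, (e_a)_(a in Phi). *)
Definition galg := {ffun (I + Phi)%type -> (R[i])^o}.

Definition gh (i : I) : galg := [ffun k => if k is inl j then (i == j)%:R else 0].

(* e_a if a is in Phi, and 0 otherwise *)
Definition ge (a : E) : galg :=
  [ffun k => if k is inr b then (a == val b)%:R else 0].

Definition ghc (a : E) : galg := \sum_i gh i *~ coefs alpha a i.

Definition gcartan : {vspace galg} := <<[seq gh i | i <- enum I]>>%VS.

Definition gbr_basis (eps : E -> E -> int) (k l : I + Phi) : galg :=
  match k, l with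
  | inl i, inl j => 0
  | inl i, inr b => (dot (alpha i) (val b))%:C *: ge (val b)
  | inr a, inl j => - ((dot (alpha j) (val a))%:C *: ge (val a))
  | inr a, inr b =>
      if val a + val b == 0 then ghc (val a) *~ eps (val a) (val b)
      else if val a + val b \in Phi then
        ge (val a + val b) *~ eps (val a) (val b)
      else 0
  end.

Definition gbr (eps : E -> E -> int) (x y : galg) : galg :=
  \sum_k \sum_l (x k * y l) *: gbr_basis eps k l.

(* The linear form on gcartan sending h_i to <alpha_i, a>. *)
Definition gwt (a : E) : 'Hom(subvs_of gcartan, (R[i])^o) :=
  linfun (fun h : subvs_of gcartan =>
    \sum_i (dot (alpha i) a)%:C * (vsval h : galg) (inl i) : (R[i])^o).

End AlgebraOfEps.

(* Main.v *)
Require Import Defs.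
From HB Require Import structures.
From mathcomp Require Import all_boot all_order all_algebra.
From mathcomp Require Import finmap.
From mathcomp Require Import boolp classical_sets reals.
From mathcomp Require Import complex.
From mathcomp Require Import zify ring lra.

Set Implicit Arguments.
Unset Strict Implicit.
Unset Printing Implicit Defensive.

Import Order.TTheory GRing.Theory Num.Theory.
Local Open Scope ring_scope.

(** Two properties of eps0 carry the whole statement. It is bimultiplicative on
    the lattice spanned by the simple roots, hence a 2-cocycle (eps0_cocycle).
    And since c_i = - c_j along the edges of the Dynkin diagram, while the
    diagonal entries of the Cartan matrix are even, its commutator is the
    parity of the scalar product (eps0_commutator).

    When all roots have squared length 2, the scalar product of two roots a and
    b lies between -2 and 2, and it decides everything about a + b: the sum is
    zero for -2, a root for -1, and neither otherwise (add_roots_eq0,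
    add_roots_in). So the bracket of two root vectors is governed by <a, b>
    (gbr_ee), and the Jacobi identity for three root vectors is a case
    distinction on three small integers. The signs that have to match in each
    case differ by a rotation of the three roots, which the cocycle identity
    reduces to a commutator (eps_rotate, jacobiator_opposite, jacobiator_eee).
    Jacobi identities involving the Cartan subalgebra only express that
    brackets add weights.

    For simplicity, an ideal is stable under the diagonalisable action of the
    Cartan subalgebra, whose nonzero weights are distinct and occur once; so it
    contains e_a as soon as one of its elements has a nonzero coordinate there
    (ideal_root_vector). The Cartan subalgebra contains no nonzero ideal,
    because the scalar product is nondegenerate (cartan_pairing_neq0). An ideal
    containing one e_a contains the co-root of a, hence e_b for every b not
    orthogonal to a, and irreducibility makes it everything (ideal_full).

    The same diagonal action identifies the weights with the roots
    (gwt_root_system). If a + b is a root then b - a is not (string_q0), so the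
    structure constants are the values of eps0, and
    eps0 (alpha_i, a) = c_i ^ <alpha_i, a> returns c_i when alpha_i + a is a
    root (eps0_simplel). Finally eps0 (x, x) (-1)^(<x, x> / 2 + ht x) is a
    homomorphism in x which is trivial on simple roots (eps0_diagonal); at a
    root, where <x, x> / 2 = 1, this is the height formula. *)

(** * Scalar products on roots and on the root lattice *)

Section ScalarProduct.
Variables (R : realType) (E : vectType R) (dot : {dot E for idfun}).

Lemma dotC a b : dot a b = dot b a.
Proof. by rewrite hermC expr0 mul1r. Qed.

Lemma dotDr a b d : dot a (b + d) = dot a b + dot a d.
Proof. exact: linearDr. Qed.

Lemma dotDl a b d : dot (a + b) d = dot a d + dot b d.
Proof. by rewrite dotC dotDr !(dotC d). Qed.

Lemma dotNr a b : dot a (- b) = - dot a b.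
Proof. exact: linearNr. Qed.

Lemma dotNl a b : dot (- a) b = - dot a b.
Proof. by rewrite dotC dotNr (dotC b). Qed.

Lemma dot0r a : dot a 0 = 0.
Proof. exact: linear0r. Qed.

Lemma dotZr a k b : dot a (k *: b) = k * dot a b.
Proof. exact: linearZr_LR. Qed.

Lemma dot_sumr (J : Type) (r : seq J) (P : pred J) (F : J -> E) a :
  dot a (\sum_(j <- r | P j) F j) = \sum_(j <- r | P j) dot a (F j).
Proof. exact: linear_sumr. Qed.

Lemma dotMzr a b n : dot a (b *~ n) = dot a b *~ n.
Proof. by rewrite -!scaler_int dotZr mulrzl. Qed.

Lemma dotMzl a b n : dot (b *~ n) a = dot b a *~ n.
Proof. by rewrite dotC dotMzr dotC. Qed.

Lemma dot_ge0 a : 0 <= dot a a.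
Proof.
have [->|a0] := eqVneq a 0; first by rewrite dot0r.
exact/ltW/neq0_dnorm_gt0.
Qed.

Lemma dot_eq0 a : dot a a = 0 -> a = 0.
Proof.
move=> aa0; apply/eqP; apply: contraT => a0.
by have := neq0_dnorm_gt0 (s := dot) a a0; rewrite aa0 ltxx.
Qed.

End ScalarProduct.

Section RootLattice.
Variables (R : realType) (E : vectType R) (dot : {dot E for idfun}).
Variables (Phi : {fset E}) (I : finType) (alpha : I -> E).

(** The root lattice, in the coordinates used by coefs: unlike the generating
    family of all roots, the simple roots give unique coefficients. *)
Definition simple_lattice (x : E) : Prop :=
  exists n : {ffun I -> int}, x = \sum_i alpha i *~ n i.

Lemma simple_lattice0 : simple_lattice 0.
Proof. by exists 0; rewrite big1 // => i _; rewrite ffunE mulr0z. Qed.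

Lemma simple_latticeD x y :
  simple_lattice x -> simple_lattice y -> simple_lattice (x + y).
Proof.
move=> [n ->] [m ->]; exists (n + m); rewrite -big_split /=.
by apply: eq_bigr => i _; rewrite ffunE mulrzDr.
Qed.

Lemma simple_latticeN x : simple_lattice x -> simple_lattice (- x).
Proof.
move=> [n ->]; exists (- n); rewrite -sumrN.
by apply: eq_bigr => i _; rewrite ffunE mulrNz.
Qed.

Lemma simple_latticeMz x k : simple_lattice x -> simple_lattice (x *~ k).
Proof.
move=> [n ->]; exists [ffun i => n i * k]; rewrite mulrz_suml.
by apply: eq_bigr => i _; rewrite ffunE mulrzA.
Qed.

Lemma simple_lattice_simple i : simple_lattice (alpha i).
Proof.
exists [ffun j => (j == i)%:R]; rewrite (bigD1 i) //= big1 ?addr0.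
  by rewrite ffunE eqxx.
by move=> j /negPf ji; rewrite ffunE ji.
Qed.

Hypothesis alpha_simple : simple_roots Phi alpha.

Lemma simple_roots_free (k : I -> R) :
  \sum_i k i *: alpha i = 0 -> forall i, k i = 0.
Proof.
move=> k0 i; have /basis_free fr := simple_basis alpha_simple.
have /freeP/(_ (fun j => k (enum_val j))) : free (codom_tuple alpha) by [].
move=> /(_ _ (enum_rank i)); rewrite enum_rankK; apply.
rewrite -[RHS]k0 [RHS](reindex (@enum_val I I)) /=; last first.
  by apply: onW_bij; exact: enum_val_bij.
apply: eq_bigr => j _; congr (_ *: _).
rewrite /codom /image_mem (nth_map (enum_val j)) -?cardE //.
by rewrite -enum_val_nth.
Qed.

Lemma coefs_sum (n : {ffun I -> int}) :
  coefs alpha (\sum_i alpha i *~ n i) = n.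
Proof.
apply: xget_unique => //= m nm; apply/ffunP => i.
apply/eqP; rewrite -subr_eq0 -(intr_eq0 R); apply/eqP.
apply: (simple_roots_free (k := fun i => (m i - n i)%:~R)).
under eq_bigr do rewrite scaler_int mulrzBr.
by rewrite sumrB nm subrr.
Qed.

Lemma coefsK x : simple_lattice x -> x = \sum_i alpha i *~ coefs alpha x i.
Proof. by move=> [n ->]; rewrite coefs_sum. Qed.

Lemma coefs0 i : coefs alpha 0 i = 0.
Proof.
have -> : 0 = \sum_i alpha i *~ (0 : {ffun I -> int}) i.
  by rewrite big1 // => j _; rewrite ffunE mulr0z.
by rewrite coefs_sum ffunE.
Qed.

Lemma coefsD x y : simple_lattice x -> simple_lattice y -> forall i,
  coefs alpha (x + y) i = coefs alpha x i + coefs alpha y i.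
Proof.
move=> [n ->] [m ->] i; rewrite !coefs_sum -big_split /=.
under eq_bigr do rewrite -mulrzDr.
suff -> : \sum_i alpha i *~ (n i + m i) = \sum_i alpha i *~ (n + m) i.
  by rewrite coefs_sum ffunE.
by apply: eq_bigr => j _; rewrite ffunE.
Qed.

Lemma coefsN x : simple_lattice x -> forall i,
  coefs alpha (- x) i = - coefs alpha x i.
Proof.
move=> Lx i; apply/eqP; rewrite -addr_eq0 -coefsD ?addNr ?coefs0 //.
exact: simple_latticeN.
Qed.

Lemma coefs_simple i j : coefs alpha (alpha i) j = (j == i)%:R.
Proof.
have {1}-> : alpha i = \sum_j alpha j *~ [ffun j => (j == i)%:R : int] j.
  rewrite (bigD1 i) //= big1 ?addr0 ?ffunE ?eqxx //.
  by move=> k /negPf ji; rewrite ffunE ji.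
by rewrite coefs_sum ffunE.
Qed.

Lemma root_simple_lattice a : a \in Phi -> simple_lattice a.
Proof.
have pos (n : I -> nat) : simple_lattice (\sum_i alpha i *+ n i).
  by exists [ffun i => (n i)%:Z]; apply: eq_bigr => i _; rewrite ffunE.
case/(simple_pos_or_neg alpha_simple) => [] [_ [n ->]] //.
exact/simple_latticeN.
Qed.

Lemma root_lattice_simple x : root_lattice Phi x -> simple_lattice x.
Proof.
move=> [n ->]; apply: (big_ind simple_lattice).
- exact: simple_lattice0.
- exact: simple_latticeD.
move=> i _; apply: simple_latticeMz; apply: root_simple_lattice.
by rewrite mem_nth.
Qed.

(** A combination of the simple roots orthogonal to all of them is orthogonal
    to itself. Real coefficients are needed for the real and imaginary parts of
    elements of the Cartan subalgebra, integral ones for the lattice. *)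
Lemma simple_roots_nondegenerate (k : I -> R) :
  (forall j, dot (alpha j) (\sum_i k i *: alpha i) = 0) -> forall i, k i = 0.
Proof.
move=> k0; apply: simple_roots_free; apply: (@dot_eq0 _ _ dot).
by rewrite dot_sumr big1 // => i _; rewrite dotZr dotC k0 mulr0.
Qed.

Lemma lattice_nondegenerate x : simple_lattice x ->
  (forall j, dot (alpha j) x = 0) -> x = 0.
Proof.
move=> /coefsK xE x0; apply: (@dot_eq0 _ _ dot).
rewrite {2}xE dot_sumr big1 // => i _.
by rewrite dotMzr dotC x0 mul0rz.
Qed.

Hypothesis Phi_roots : root_system dot Phi.
Hypothesis dot_normalised : forall a, a \in Phi -> dot a a = 2.

Lemma cartan_numberE a b : a \in Phi -> cartan_number dot a b = dot a b.
Proof.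
move=> Pa; rewrite /cartan_number dot_normalised //.
by rewrite mulrAC divff ?mul1r ?pnatr_eq0.
Qed.

Lemma dot_root_int a b : a \in Phi -> b \in Phi -> dot a b \is a Num.int.
Proof.
move=> Pa Pb; rewrite -cartan_numberE //.
exact: (roots_crystallographic Phi_roots).
Qed.

Lemma dotzE a b : simple_lattice a -> simple_lattice b ->
  (dotz dot a b)%:~R = dot a b.
Proof.
move=> La Lb; apply/floorK; rewrite (coefsK La) (coefsK Lb) dot_sumr.
apply: rpred_sum => i _; rewrite dotC dot_sumr.
apply: rpred_sum => j _; rewrite dotMzr dotMzl rpredMz // rpredMz //.
by apply: dot_root_int; exact: (simple_in alpha_simple).
Qed.

Lemma dotz_eq a b k : dot a b = k%:~R -> dotz dot a b = k.
Proof. by rewrite /dotz => ->; rewrite intrKfloor. Qed.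

Lemma dotzC a b : dotz dot a b = dotz dot b a.
Proof. by rewrite /dotz dotC. Qed.

Lemma dotzDr a b d : simple_lattice a -> simple_lattice b -> simple_lattice d ->
  dotz dot a (b + d) = dotz dot a b + dotz dot a d.
Proof. by move=> La Lb Ld; apply: dotz_eq; rewrite dotDr rmorphD /= !dotzE. Qed.

Lemma dotzDl a b d : simple_lattice a -> simple_lattice b -> simple_lattice d ->
  dotz dot (a + b) d = dotz dot a d + dotz dot b d.
Proof. by move=> La Lb Ld; rewrite dotzC dotzDr // !(dotzC d). Qed.

Lemma dotzNr a b : simple_lattice a -> simple_lattice b ->
  dotz dot a (- b) = - dotz dot a b.
Proof. by move=> La Lb; apply: dotz_eq; rewrite dotNr rmorphN /= dotzE. Qed.

Lemma dotzNl a b : simple_lattice a -> simple_lattice b ->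
  dotz dot (- a) b = - dotz dot a b.
Proof. by move=> La Lb; rewrite dotzC dotzNr // dotzC. Qed.

Lemma dotz_root a : a \in Phi -> dotz dot a a = 2.
Proof. by move=> Pa; apply: dotz_eq; rewrite dot_normalised. Qed.

Lemma root_neq0 a : a \in Phi -> a != 0.
Proof.
by move=> Pa; apply: contraNneq (roots_neq0 Phi_roots) => <-.
Qed.

Lemma opp_root a : a \in Phi -> - a \in Phi.
Proof.
move=> Pa; have := roots_reflection Phi_roots Pa Pa.
by rewrite cartan_numberE // dot_normalised // scaler_nat mulr2n opprD addNKr.
Qed.

(** Positivity of the squared lengths 4 + 2 <a, b> and 4 - 2 <a, b> of a + b
    and a - b. *)
Lemma dotz_root_ge a b : a \in Phi -> b \in Phi -> -2 <= dotz dot a b <= 2.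
Proof.
move=> Pa Pb; have La := root_simple_lattice Pa.
have Lb := root_simple_lattice Pb.
have := dot_ge0 dot (a + b); have := dot_ge0 dot (a - b).
rewrite !dotDl !dotDr !dotNl !dotNr (dotC dot b a) !dot_normalised // -dotzE //.
move=> h1 h2; rewrite -!(ler_int R) !rmorphN /=.
by apply/andP; split; lra.
Qed.

(** The squared length of a + b is 4 + 2 <a, b>. *)
Lemma add_roots_eq0 a b : a \in Phi -> b \in Phi ->
  (a + b == 0) = (dotz dot a b == -2).
Proof.
move=> Pa Pb; have La := root_simple_lattice Pa.
have Lb := root_simple_lattice Pb.
apply/eqP/eqP => [/eqP|ab].
  rewrite addr_eq0 => /eqP aE; apply: dotz_eq.
  by rewrite aE dotNl dot_normalised // rmorphN.
apply: (@dot_eq0 _ _ dot).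
rewrite dotDl !dotDr (dotC dot b a) !dot_normalised // -dotzE // ab rmorphN /=.
lra.
Qed.

(** A root a + b has squared length 4 + 2 <a, b> = 2; conversely, if
    <a, b> = -1 then a + b is the reflection of b along a. *)
Lemma add_roots_in a b : a \in Phi -> b \in Phi ->
  (a + b \in Phi) = (dotz dot a b == -1).
Proof.
move=> Pa Pb; have La := root_simple_lattice Pa.
have Lb := root_simple_lattice Pb.
apply/idP/eqP => [Pab|ab].
  apply: dotz_eq; have := dot_normalised Pab.
  rewrite dotDl !dotDr (dotC dot b a) !dot_normalised // rmorphN /=.
  lra.
have := roots_reflection Phi_roots Pa Pb.
by rewrite cartan_numberE // -dotzE // ab rmorphN /= scaleN1r opprK addrC.
Qed.

Lemma nat_max0 (S : set nat) : S 0%N -> (forall m, S m.+1 -> False) ->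
  nat_max S = 0%N.
Proof.
move=> S0 Sn; apply: xget_unique => [|m [Sm _]].
  by split=> // [] [|k] // /Sn.
by case: m Sm => // m /Sn.
Qed.

(** The squared length 2 + 2 m <a, b> + 2 m^2 of b + m a exceeds 2 for m > 0. *)
Lemma string_add_root a b : a \in Phi -> b \in Phi -> 0 <= dotz dot a b ->
  string_p Phi a b = 0%N.
Proof.
move=> Pa Pb ab; have La := root_simple_lattice Pa.
have Lb := root_simple_lattice Pb.
apply: nat_max0 => [|m]; rewrite /= ?addr0 // => Pab.
have := dot_normalised Pab; rewrite pmulrn dotDl !dotDr (dotC dot (_ *~ _) b).
rewrite dotMzr dotMzr dotMzl (dotC dot b a) !dot_normalised // -dotzE // => h.
have : 2 + dotz dot a b *~ m.+1%:Z +
    (dotz dot a b *~ m.+1%:Z + 2 *~ m.+1%:Z *~ m.+1%:Z) = 2.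
  by apply: (@intr_inj R); rewrite !rmorphD /= !rmorphMz /=.
by rewrite !mulrzz; nia.
Qed.

Lemma string_pN a b : string_p Phi (- a) b = string_q Phi a b.
Proof. by congr nat_max; apply: funext => m /=; rewrite mulNrn. Qed.

End RootLattice.

(** * The sign function eps0 *)

Section Signs.

Lemma sign_unit s : is_sign s -> s \is a GRing.unit.
Proof. by case=> ->. Qed.

Lemma signM s t : is_sign s -> is_sign t -> is_sign (s * t).
Proof. by case=> -> [] ->; [left|right|right|left]. Qed.

Lemma signX s (n : int) : is_sign s -> is_sign (s ^ n).
Proof.
case=> ->; first by left; rewrite exp1rz.
rewrite /exprz; case: n => n; rewrite -signr_odd; case: (odd _);
  by [left|right].
Qed.

Lemma sign_mulrr s : is_sign s -> s * s = 1.
Proof. by case=> ->. Qed.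

Lemma sign_exp2 s (n : int) : is_sign s -> s ^ (2 * n) = 1.
Proof.
move=> ss; rewrite mulr2n mulrDl mul1r exprzDr ?sign_unit //.
by rewrite sign_mulrr //; exact: signX.
Qed.

Lemma expN1zD (m n : int) : (-1 : int) ^ (m + n) = (-1) ^ m * (-1) ^ n.
Proof. exact: exprzDr. Qed.

Lemma expN1zN1 : (-1 : int) ^ (-1) = -1.
Proof. by rewrite exprN1 invrN1. Qed.

Lemma expN1zN2 : (-1 : int) ^ (-2) = 1.
Proof. by rewrite (_ : -2 = 2 * -1) // sign_exp2 //; right. Qed.

End Signs.

Section StandardCocycle.
Variables (R : realType) (E : vectType R) (dot : {dot E for idfun}).
Variables (Phi : {fset E}) (I : finType) (alpha : I -> E) (c : I -> int).
Hypothesis alpha_simple : simple_roots Phi alpha.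
Hypothesis Phi_roots : root_system dot Phi.
Hypothesis dot_normalised : forall a, a \in Phi -> dot a a = 2.
Hypothesis c_sign : forall i, is_sign (c i).
Hypothesis c_alternating : forall i j,
  i != j -> cartan_matrix dot alpha i j != 0 -> c i = - c j.

Local Notation Q := (simple_lattice alpha).
Local Notation eps := (eps0 dot alpha c).
Local Notation A := (cartan_matrix dot alpha).
Local Notation n_ := (coefs alpha).

Lemma cartan_matrixE i j : A i j = dotz dot (alpha i) (alpha j).
Proof.
rewrite /cartan_matrix (cartan_numberE dot_normalised) //.
exact: (simple_in alpha_simple).
Qed.

Lemma dotz_coefs x y : Q x -> Q y ->
  dotz dot x y = \sum_i \sum_j A i j * n_ x i * n_ y j.
Proof.
move=> Qx Qy; apply: dotz_eq; rewrite {1}(coefsK alpha_simple Qx).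
rewrite dotC dot_sumr rmorph_sum; apply: eq_bigr => i _ /=.
rewrite dotMzr dotC {1}(coefsK alpha_simple Qy) dot_sumr.
rewrite mulrz_suml rmorph_sum; apply: eq_bigr => j _ /=.
rewrite dotMzr cartan_matrixE !rmorphM /= (dotzE alpha_simple) //;
  try exact: simple_lattice_simple.
by rewrite !mulrzr mulrzAC.
Qed.

Lemma eps0Dl x y z : Q x -> Q y -> eps (x + y) z = eps x z * eps y z.
Proof.
move=> Qx Qy; rewrite -big_split; apply: eq_bigr => i _ /=.
rewrite -big_split; apply: eq_bigr => j _ /=.
by rewrite (coefsD alpha_simple) // mulrDr mulrDl exprzDr // sign_unit.
Qed.

Lemma eps0Dr x y z : Q y -> Q z -> eps x (y + z) = eps x y * eps x z.
Proof.
move=> Qx Qy; rewrite -big_split; apply: eq_bigr => i _ /=.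
rewrite -big_split; apply: eq_bigr => j _ /=.
by rewrite (coefsD alpha_simple) // mulrDr exprzDr // sign_unit.
Qed.

Lemma eps00l x : eps 0 x = 1.
Proof.
by rewrite /eps0 !big1 // => i _; rewrite big1 // => j _;
  rewrite (coefs0 alpha_simple) mulr0 mul0r expr0z.
Qed.

Lemma eps00r x : eps x 0 = 1.
Proof.
by rewrite /eps0 !big1 // => i _; rewrite big1 // => j _;
  rewrite (coefs0 alpha_simple) mulr0 expr0z.
Qed.

Lemma eps0_sign x y : is_sign (eps x y).
Proof.
rewrite /eps0; apply: (big_ind is_sign) => [||i _]; [by left|exact: signM|].
by apply: (big_ind is_sign) => [||j _]; [by left|exact: signM|exact: signX].
Qed.

(** A homomorphism to the signs does not distinguish x from its inverse. *)
Lemma eps0Nl x y : Q x -> eps (- x) y = eps x y.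
Proof.
move=> Qx; have := eps0Dl y Qx (simple_latticeN Qx); rewrite subrr eps00l.
by case: (eps0_sign x y) (eps0_sign (- x) y) => -> [] ->.
Qed.

Lemma eps0Nr x y : Q y -> eps x (- y) = eps x y.
Proof.
move=> Qy; have := eps0Dr x Qy (simple_latticeN Qy); rewrite subrr eps00r.
by case: (eps0_sign x y) (eps0_sign x (- y)) => -> [] ->.
Qed.

Lemma eps0_cocycle x y z : Q x -> Q y -> Q z ->
  eps x y * eps (x + y) z = eps y z * eps x (y + z).
Proof. by move=> Qx Qy Qz; rewrite eps0Dl // eps0Dr //; ring. Qed.

(** The (i, j) factor of the product is (c_i c_j)^(a_ij n_i m_j): off the
    diagonal c_i c_j = -1 whenever a_ij is nonzero, and on the diagonal both
    sides have an even exponent. *)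
Lemma eps0_commutator x y : Q x -> Q y ->
  eps x y * eps y x = (-1) ^ dotz dot x y.
Proof.
move=> Qx Qy; rewrite {2}/eps0 exchange_big dotz_coefs //=.
rewrite (big_morph _ expN1zD (expr0z _)) -big_split; apply: eq_bigr => i _ /=.
rewrite (big_morph _ expN1zD (expr0z _)) -big_split; apply: eq_bigr => j _ /=.
have -> : A j i * n_ y j * n_ x i = A i j * n_ x i * n_ y j.
  by rewrite !cartan_matrixE dotzC mulrAC.
have [->|ij] := eqVneq i j.
  (* a_ii = 2 makes all exponents even *)
  have Pj := simple_in alpha_simple j.
  rewrite cartan_matrixE (dotz_root dot_normalised) //.
  by rewrite -!mulrA !sign_exp2 //; right.
have [->|Aij] := eqVneq (A i j) 0; first by rewrite !mul0r !expr0z.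
rewrite -exprzMl ?sign_unit // (c_alternating ij Aij) mulNr.
by rewrite sign_mulrr.
Qed.

(** Only the factors of row i survive, and their exponents add up to
    <alpha_i, x>. *)
Lemma eps0_simplel i x : Q x -> eps (alpha i) x = c i ^ dotz dot (alpha i) x.
Proof.
move=> Qx; rewrite dotz_coefs //; last exact: simple_lattice_simple.
rewrite (bigD1 i) //= [X in _ + X]big1 ?addr0; last first.
  move=> j /negPf ji; rewrite big1 // => k _.
  by rewrite (coefs_simple alpha_simple) ji mulr0 mul0r.
rewrite /eps0 (bigD1 i) //= [X in _ * X]big1 ?mulr1; last first.
  move=> j /negPf ji; rewrite big1 // => k _.
  by rewrite (coefs_simple alpha_simple) ji mulr0 mul0r expr0z.
have ciD : {morph exprz (c i) : m n / m + n >-> m * n}.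
  by move=> m n; rewrite exprzDr // sign_unit.
rewrite (big_morph _ ciD (expr0z _)); apply: eq_bigr => j _.
by rewrite (coefs_simple alpha_simple) eqxx.
Qed.

Lemma heightD x y : Q x -> Q y ->
  height alpha (x + y) = height alpha x + height alpha y.
Proof.
move=> Qx Qy; rewrite -big_split.
by apply: eq_bigr => i _; rewrite (coefsD alpha_simple).
Qed.

(** Passing from y and z to y + z multiplies both sides of the formula for
    eps0 (x, x) by (-1)^<y, z>: the left one through the commutator of eps0,
    the right one through
    <y + z, y + z> / 2 = <y, y> / 2 + <z, z> / 2 + <y, z>. So it suffices to
    know the formula on simple roots, where k = ht x = 1. *)
Lemma eps0_diagonal x : Q x -> exists2 k : int,
  dotz dot x x = 2 * k & eps x x = (-1) ^ (k + height alpha x).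
Proof.
pose P x := Q x /\ exists2 k : int,
  dotz dot x x = 2 * k & eps x x = (-1) ^ (k + height alpha x).
suff : Q x -> P x by move=> h /h [].
have P0 : P 0.
  split; first exact: simple_lattice0.
  exists 0; first by apply: dotz_eq; rewrite dot0r.
  rewrite eps00l /height big1 ?addr0 ?expr0z // => i _.
  exact: (coefs0 alpha_simple).
have PD y z : P y -> P z -> P (y + z).
  move=> [Qy [k yy ey]] [Qz [l zz ez]]; split; first exact: simple_latticeD.
  have Qyz := simple_latticeD Qy Qz.
  exists (k + l + dotz dot y z).
    rewrite (dotzDl alpha_simple) // !(dotzDr alpha_simple) // yy zz.
    by rewrite (dotzC dot z y); ring.
  rewrite eps0Dl // !eps0Dr //.
  transitivity (eps y y * eps z z * (eps y z * eps z y)); first by ring.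
  rewrite ey ez eps0_commutator // heightD // -!expN1zD; congr (_ ^ _); ring.
have PN y : P y -> P (- y).
  move=> [Qy [k yy ey]]; have QNy := simple_latticeN Qy; split=> //.
  exists k.
    by rewrite (dotzNl alpha_simple) // (dotzNr alpha_simple) // opprK.
  rewrite eps0Nl // eps0Nr // ey.
  (* ht (- y) = - ht y has the same parity as ht y *)
  have -> : k + height alpha y = k + height alpha (- y) + 2 * height alpha y.
    have := heightD Qy QNy; rewrite subrr {1}/height big1 => [h|i _].
      by lia.
    exact: (coefs0 alpha_simple).
  by rewrite expN1zD sign_exp2 ?mulr1 //; right.
have PMn y n : P y -> P (y *+ n).
  by move=> Py; elim: n => [|n IH]; rewrite ?mulr0n // mulrS; apply: PD.
have Palpha i : P (alpha i).
  have Qi : Q (alpha i) by exact: simple_lattice_simple.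
  split=> //; exists 1.
    by rewrite (dotz_root dot_normalised) ?(simple_in alpha_simple).
  have Pi := simple_in alpha_simple i.
  rewrite eps0_simplel // (dotz_root dot_normalised) //.
  rewrite -[2]mulr1 sign_exp2 // /height (bigD1 i) //= big1 => [|j /negPf ji].
    by rewrite (coefs_simple alpha_simple) eqxx.
  by rewrite (coefs_simple alpha_simple) ji.
move=> /(coefsK alpha_simple) ->.
apply: (big_ind P) => // i _.
case: (n_ x i) => n; first by rewrite -pmulrn; exact: PMn.
by rewrite NegzE mulrNz -pmulrn; apply: PN; exact: PMn.
Qed.

Lemma eps0_root_diagonal a : a \in Phi ->
  eps a a = eps a (- a) /\ eps a (- a) = - (-1) ^ height alpha a.
Proof.
move=> Pa; have Qa := root_simple_lattice alpha_simple Pa.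
have [k] := eps0_diagonal Qa; rewrite (dotz_root dot_normalised) // => k1.
have {k1}-> : k = 1 by lia.
rewrite expN1zD expr1z mulN1r => ea.
by rewrite eps0Nr.
Qed.

End StandardCocycle.

(** * Intersections and products of subspaces *)

Section LieProducts.
Variables (K : fieldType) (L : vectType K) (br : L -> L -> L).

Lemma memv_bigcap_seq (J : Type) (r : seq J) (F : J -> {vspace L}) x :
  (x \in (\bigcap_(j <- r) F j)%VS) = all (fun j => x \in F j) r.
Proof.
elim: r => [|j r IH]; first by rewrite big_nil memvf.
by rewrite big_cons memv_cap IH.
Qed.

Hypothesis br_linearl : forall z, linear (br^~ z).
Hypothesis br_linearr : forall z, linear (br z).

Lemma memv_lie_prod (U V : {vspace L}) x y :
  x \in U -> y \in V -> br x y \in lie_prod br U V.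
Proof.
have span u v : u \in vbasis U -> v \in vbasis V -> br u v \in lie_prod br U V.
  by move=> uU vV; apply: memv_span; exact: allpairs_f.
have br0l z : br 0 z = 0.
  by have := br_linearl z (-1) 0 0; rewrite scaler0 addr0 scaleN1r addNr.
have br0r z : br z 0 = 0.
  by have := br_linearr z (-1) 0 0; rewrite scaler0 addr0 scaleN1r addNr.
have right v : v \in vbasis V ->
    forall u, u \in U -> br u v \in lie_prod br U V.
  move=> vV u /coord_vbasis ->; elim/big_ind: _ => [|u1 u2 h1 h2|i _].
  - by rewrite br0l mem0v.
  - by rewrite -[u1]scale1r br_linearl scale1r memvD.
  rewrite -[X in br X]addr0 br_linearl br0l addr0 memvZ // span //.
  by rewrite mem_nth ?size_tuple.
move=> xU /coord_vbasis ->; elim/big_ind: _ => [|u1 u2 h1 h2|i _].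
- by rewrite br0r mem0v.
- by rewrite -[u1]scale1r br_linearr scale1r memvD.
rewrite -[X in br _ X]addr0 br_linearr br0r addr0 memvZ // right //.
by rewrite mem_nth ?size_tuple.
Qed.

End LieProducts.


(** * The algebra attached to a sign function *)

Section AlgebraStructure.
Variables (R : realType) (E : vectType R) (dot : {dot E for idfun}).
Variables (Phi : {fset E}) (I : finType) (alpha : I -> E).
Variable eps : E -> E -> int.

Local Notation C := R[i].
Local Notation g := (galg Phi I).
Local Notation br := (@gbr R E dot Phi I alpha eps).
Local Notation h_ := (@gh R E Phi I).
Local Notation e_ := (@ge R E Phi I).
Local Notation hc := (ghc Phi alpha).
Local Notation H := (@gcartan R E Phi I).
Local Notation wt := (gwt dot Phi alpha).

Lemma gbr_linearl z : linear (br^~ z).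
Proof.
move=> a x y; rewrite /gbr scaler_sumr -big_split; apply: eq_bigr => k _ /=.
rewrite scaler_sumr -big_split; apply: eq_bigr => l _ /=.
by rewrite !ffunE mulrDl scalerDl scalerA mulrA.
Qed.

Lemma gbr_linearr z : linear (br z).
Proof.
move=> a x y; rewrite /gbr scaler_sumr -big_split; apply: eq_bigr => k _ /=.
rewrite scaler_sumr -big_split; apply: eq_bigr => l _ /=.
by rewrite !ffunE mulrDr scalerDl scalerA mulrCA.
Qed.

HB.instance Definition _ z :=
  GRing.isLinear.Build C g g *:%R (br z) (gbr_linearr z).

Lemma gbrDl x y z : br (x + y) z = br x z + br y z.
Proof. by have := gbr_linearl z 1 x y; rewrite !scale1r. Qed.

Lemma gbr0l z : br 0 z = 0.
Proof. by apply: (addrI (br 0 z)); rewrite -gbrDl !addr0. Qed.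

Lemma gbrZl a x z : br (a *: x) z = a *: br x z.
Proof. by have := gbr_linearl z a x 0; rewrite gbr0l !addr0. Qed.

Lemma gbr_suml (J : Type) (r : seq J) (P : pred J) (F : J -> g) z :
  br (\sum_(j <- r | P j) F j) z = \sum_(j <- r | P j) br (F j) z.
Proof. exact: (big_morph (br^~ z) (fun x y => gbrDl x y z) (gbr0l z)). Qed.

Lemma gbrMzl x n z : br (x *~ n) z = br x z *~ n.
Proof. by rewrite -scaler_int gbrZl scaler_int. Qed.

Lemma gbrMzr x n z : br z (x *~ n) = br z x *~ n.
Proof. exact: raddfMz. Qed.

Lemma galgZE (a : C) (x : g) k : (a *: x) k = a * x k.
Proof. by rewrite ffunE. Qed.

Definition gbasis (k : I + Phi) : g :=
  match k with inl i => h_ i | inr a => e_ (val a) end.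

Lemma gbasisE k l : gbasis k l = (k == l)%:R.
Proof. by case: k l => [i|a] [j|b]; rewrite ffunE. Qed.

Lemma gbasis_expansion (x : g) : x = \sum_k x k *: gbasis k.
Proof.
apply/ffunP => l; rewrite sum_ffunE (bigD1 l) //= big1 ?addr0.
  by rewrite galgZE gbasisE eqxx mulr1.
by move=> k /negPf kl; rewrite galgZE gbasisE kl mulr0.
Qed.

Lemma linear_eq0_basis (f : g -> g) :
  linear f -> (forall k, f (gbasis k) = 0) -> forall x, f x = 0.
Proof.
move=> lf f0 x; rewrite (gbasis_expansion x).
have f00 : f 0 = 0.
  by have := lf (-1) 0 0; rewrite scaler0 addr0 scaleN1r addNr.
elim/big_ind: _ => // [u v fu fv|k _].
  by have := lf 1 u v; rewrite !scale1r fu fv addr0.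
by have := lf (x k) (gbasis k) 0; rewrite !addr0 f0 f00 scaler0 addr0.
Qed.

Lemma gbr_basisE k l : br (gbasis k) (gbasis l) = gbr_basis dot alpha eps k l.
Proof.
rewrite /gbr (bigD1 k) //= (bigD1 l) //= !gbasisE !eqxx mulr1 scale1r.
rewrite !big1 ?addr0 // => [k' /negPf kk|l' /negPf ll].
  by rewrite big1 // => l' _; rewrite !gbasisE eq_sym kk mul0r scale0r.
by rewrite !gbasisE (eq_sym l) ll mulr0 scale0r.
Qed.

Lemma ge_notin a : a \notin Phi -> e_ a = 0.
Proof.
move=> aP; apply/ffunP => -[i|b]; rewrite !ffunE //.
by case: eqP => // ab; move: aP; rewrite ab (valP b).
Qed.

Lemma gbr_hh i j : br (h_ i) (h_ j) = 0.
Proof. exact: (gbr_basisE (inl i) (inl j)). Qed.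

Lemma gbr_he i a : br (h_ i) (e_ a) = (dot (alpha i) a)%:C%C *: e_ a.
Proof.
have [Pa|/ge_notin->] := boolP (a \in Phi); last by rewrite linear0 scaler0.
exact: (gbr_basisE (inl i) (inr [` Pa]%fset)).
Qed.

Lemma gbr_eh i a : br (e_ a) (h_ i) = - br (h_ i) (e_ a).
Proof.
rewrite gbr_he; have [Pa|/ge_notin->] := boolP (a \in Phi).
  exact: (gbr_basisE (inr [` Pa]%fset) (inl i)).
by rewrite gbr0l scaler0 oppr0.
Qed.

Lemma gbr_ee_def a b : a \in Phi -> b \in Phi -> br (e_ a) (e_ b) =
  if a + b == 0 then hc a *~ eps a b
  else if a + b \in Phi then e_ (a + b) *~ eps a b else 0.
Proof.
by move=> Pa Pb; exact: (gbr_basisE (inr [` Pa]%fset) (inr [` Pb]%fset)).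
Qed.

(** The value at h of the linear form attached to a; in particular
    it is <b, a> for h the co-root of b. *)
Definition cartan_pairing (h : g) (a : E) : C :=
  \sum_i (dot (alpha i) a)%:C%C * h (inl i).

Lemma gcartanP (h : g) :
  reflect (forall a, h (inr a) = 0) (h \in H).
Proof.
apply: (iffP idP) => [/(@coord_span _ _ _ (in_tuple _))-> a|h0].
  rewrite sum_ffunE big1 // => j _; rewrite galgZE.
  set X := in_tuple _; have /mapP[i _ ->] : X`_j \in X by rewrite mem_nth.
  by rewrite ffunE mulr0.
rewrite (gbasis_expansion h); apply: rpred_sum => -[i|a] _.
  by apply/memvZ/memv_span/map_f; rewrite mem_enum.
by rewrite h0 scale0r mem0v.
Qed.

Lemma gh_in_cartan i : h_ i \in H.
Proof. by apply/gcartanP => a; rewrite ffunE. Qed.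

Lemma gcartan_expansion h :
  h \in H -> h = \sum_i h (inl i) *: h_ i.
Proof.
move=> /gcartanP h0; rewrite {1}(gbasis_expansion h) big_sumType /=.
by rewrite [X in _ + X]big1 ?addr0 // => a _; rewrite h0 scale0r.
Qed.

Lemma gbr_cartan_root h a :
  h \in H -> br h (e_ a) = cartan_pairing h a *: e_ a.
Proof.
move=> /gcartan_expansion {1}->; rewrite gbr_suml scaler_suml.
by apply: eq_bigr => i _; rewrite gbrZl gbr_he scalerA mulrC.
Qed.

(** The basis diagonalises the Cartan subalgebra; the h_i have weight 0. *)
Definition weight_of (k : I + Phi) : E := if k is inr a then val a else 0.

Lemma cartan_pairing0 h : cartan_pairing h 0 = 0.
Proof. by rewrite /cartan_pairing big1 // => i _; rewrite dot0r mul0r. Qed.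

Lemma gbr_cartan_basis h k : h \in H ->
  br h (gbasis k) = cartan_pairing h (weight_of k) *: gbasis k.
Proof.
move=> Hh; case: k => [i|a] /=; last exact: gbr_cartan_root.
rewrite cartan_pairing0 scale0r (gcartan_expansion Hh) gbr_suml big1 // => j _.
by rewrite gbrZl gbr_hh scaler0.
Qed.

Lemma gbr_cartan h x k : h \in H ->
  br h x k = cartan_pairing h (weight_of k) * x k.
Proof.
move=> Hh; rewrite {1}(gbasis_expansion x) linear_sum sum_ffunE.
rewrite (bigD1 k) //= big1 => [|l /negPf lk];
  rewrite linearZ /= gbr_cartan_basis // !galgZE gbasisE.
  by rewrite eqxx mulr1 addr0 mulrC.
by rewrite lk !mulr0.
Qed.

Lemma cartan_pairing_gh i a : cartan_pairing (h_ i) a = (dot (alpha i) a)%:C%C.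
Proof.
rewrite /cartan_pairing (bigD1 i) //= big1 => [|j /negPf ji].
  by rewrite ffunE eqxx mulr1 addr0.
by rewrite ffunE eq_sym ji mulr0.
Qed.

Lemma ghc_coord a i : hc a (inl i) = (coefs alpha a i)%:~R.
Proof.
rewrite sum_ffunE (bigD1 i) //= big1 => [|j /negPf ji].
  by rewrite -scaler_int galgZE ffunE eqxx mulr1 addr0.
by rewrite -scaler_int galgZE ffunE ji mulr0.
Qed.

Lemma ghc_in_cartan a : hc a \in H.
Proof.
by apply: rpred_sum => i _; apply: rpredMz; exact: gh_in_cartan.
Qed.

Hypothesis alpha_simple : simple_roots Phi alpha.
Hypothesis Phi_roots : root_system dot Phi.
Hypothesis dot_normalised : forall a, a \in Phi -> dot a a = 2.

Local Notation Q := (simple_lattice alpha).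
Local Notation "<| a , b |>" := (dotz dot a b).

Let PhiQ a : a \in Phi -> Q a.
Proof. exact: root_simple_lattice. Qed.

Local Notation dzDl := (dotzDl alpha_simple Phi_roots dot_normalised).
Local Notation dzDr := (dotzDr alpha_simple Phi_roots dot_normalised).
Local Notation dzNr := (dotzNr alpha_simple Phi_roots dot_normalised).
Local Notation dzNl := (dotzNl alpha_simple Phi_roots dot_normalised).
Local Notation dzE := (dotzE alpha_simple Phi_roots dot_normalised).
Local Notation root_ge := (dotz_root_ge alpha_simple Phi_roots dot_normalised).
Local Notation add_eq0 := (add_roots_eq0 alpha_simple Phi_roots dot_normalised).
Local Notation add_in := (add_roots_in alpha_simple Phi_roots dot_normalised).

Lemma cartan_pairing_ghc a b : Q a -> cartan_pairing (hc a) b = (dot a b)%:C%C.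
Proof.
move=> Qa; rewrite [in RHS](coefsK alpha_simple Qa) dotC dot_sumr rmorph_sum.
apply: eq_bigr => i _ /=; rewrite ghc_coord dotMzr dotC.
by rewrite rmorphMz mulrzr.
Qed.

Lemma ghcD a b : Q a -> Q b -> hc (a + b) = hc a + hc b.
Proof.
move=> Qa Qb; rewrite -big_split; apply: eq_bigr => i _ /=.
by rewrite (coefsD alpha_simple) // mulrzDr.
Qed.

Lemma ghcN a : Q a -> hc (- a) = - hc a.
Proof.
move=> Qa; rewrite -sumrN; apply: eq_bigr => i _ /=.
by rewrite (coefsN alpha_simple) // mulrNz.
Qed.

Lemma ghc0 : hc 0 = 0.
Proof.
by rewrite /ghc big1 // => i _; rewrite (coefs0 alpha_simple) mulr0z.
Qed.

Lemma gbr_ghc a b : Q a -> Q b -> br (hc a) (e_ b) = e_ b *~ <|a, b|>.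
Proof.
move=> Qa Qb; rewrite gbr_cartan_root ?ghc_in_cartan // cartan_pairing_ghc //.
by rewrite -dzE // rmorph_int scaler_int.
Qed.

Lemma gbr_e_ghc a b : Q a -> Q b -> br (e_ a) (hc b) = - (e_ a *~ <|b, a|>).
Proof.
move=> Qa Qb; rewrite -gbr_ghc // /ghc linear_sum gbr_suml -sumrN.
by apply: eq_bigr => i _ /=; rewrite gbrMzr gbrMzl gbr_eh mulNrz.
Qed.

Lemma gbr_ee a b : a \in Phi -> b \in Phi -> br (e_ a) (e_ b) =
  if <|a, b|> == -2 then hc a *~ eps a b
  else if <|a, b|> == -1 then e_ (a + b) *~ eps a b else 0.
Proof.
move=> Pa Pb; rewrite gbr_ee_def //.
rewrite add_eq0 //.
by rewrite add_in.
Qed.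

(** * The Jacobi identity *)

Hypothesis eps_sign : forall a b, Q a -> Q b -> is_sign (eps a b).
Hypothesis eps_cocycle : forall a b d, Q a -> Q b -> Q d ->
  eps a b * eps (a + b) d = eps b d * eps a (b + d).
Hypothesis eps0l : forall a, Q a -> eps 0 a = 1.
Hypothesis eps_commutator : forall a b, Q a -> Q b ->
  eps a b * eps b a = (-1) ^ <|a, b|>.

Lemma eps_swap a b : Q a -> Q b -> eps b a = eps a b * (-1) ^ <|a, b|>.
Proof.
by move=> Qa Qb; rewrite -eps_commutator // mulrA sign_mulrr ?mul1r //;
  exact: eps_sign.
Qed.

(** For opposite roots the sign comes from the co-root, as the commutator
    exponent is -2; for a root a + b it comes from the exponent -1. *)
Lemma gbr_antisym x y : br x y = - br y x.
Proof.
have ee a b : a \in Phi -> b \in Phi -> br (e_ a) (e_ b) = - br (e_ b) (e_ a).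
  move=> Pa Pb; have Qa := PhiQ Pa; have Qb := PhiQ Pb.
  rewrite !gbr_ee // (eps_swap Qa Qb) (dotzC dot b a).
  have [ab|_] := eqVneq <|a, b|> (-2).
    have : a + b == 0 by rewrite add_eq0 // ab.
    rewrite addrC addr_eq0 ab expN1zN2 mulr1 => /eqP->.
    by rewrite ghcN // mulNrz opprK.
  have [->|_] := eqVneq <|a, b|> (-1); last by rewrite oppr0.
  by rewrite expN1zN1 mulrN1 mulrNz opprK addrC.
apply/eqP; rewrite -addr_eq0; apply/eqP; move: x.
apply: linear_eq0_basis => [a u v|k].
  by rewrite gbr_linearl gbr_linearr scalerDr addrACA.
move: y; apply: linear_eq0_basis => [a u v|l].
  by rewrite gbr_linearl gbr_linearr scalerDr addrACA.
case: k l => [i|a] [j|b] /=.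
- by rewrite !gbr_hh addr0.
- by rewrite gbr_eh subrr.
- by rewrite gbr_eh addNr.
- by rewrite ee ?addNr //; exact: fsvalP.
Qed.

Definition jacobiator x y z := br x (br y z) + br y (br z x) + br z (br x y).

Lemma jacobiatorC x y z : jacobiator x y z = jacobiator y z x.
Proof. by rewrite /jacobiator -addrA addrC. Qed.

Lemma jacobiator_linear y z : linear (fun x => jacobiator x y z).
Proof.
move=> a u v; rewrite /jacobiator.
rewrite !(gbr_linearl, gbr_linearr) !scalerDr.
by rewrite (addrACA (a *: br u _)) (addrACA (a *: _ + _)).
Qed.

Lemma jacobiator_hhh i j k : jacobiator (h_ i) (h_ j) (h_ k) = 0.
Proof. by rewrite /jacobiator !gbr_hh !linear0 !addr0. Qed.

Lemma jacobiator_hhe i j a : jacobiator (h_ i) (h_ j) (e_ a) = 0.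
Proof.
rewrite /jacobiator gbr_hh linear0 addr0 (gbr_eh i) linearN /= !gbr_he.
rewrite !linearZ /= !gbr_he scalerN !scalerA.
by rewrite mulrC subrr.
Qed.

(** Weights add under the bracket, which is what the Jacobi identity with one
    element of the Cartan subalgebra amounts to. *)
Lemma gbr_h_ee i a b : a \in Phi -> b \in Phi ->
  br (h_ i) (br (e_ a) (e_ b)) =
  (dot (alpha i) (a + b))%:C%C *: br (e_ a) (e_ b).
Proof.
move=> Pa Pb; rewrite gbr_ee_def //; case: eqP => [->|_].
  rewrite dot0r scale0r gbrMzr [br _ _](_ : _ = 0) ?mul0rz //.
  rewrite linear_sum big1 // => j _ /=.
  by rewrite gbrMzr gbr_hh mul0rz.
case: ifP => _; last by rewrite linear0 scaler0.
by rewrite gbrMzr gbr_he -scalerMzr.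
Qed.

Lemma jacobiator_hee i a b : a \in Phi -> b \in Phi ->
  jacobiator (h_ i) (e_ a) (e_ b) = 0.
Proof.
move=> Pa Pb; rewrite /jacobiator gbr_h_ee // gbr_eh linearN /= !gbr_he.
rewrite !linearZ /= (gbr_antisym (e_ b)) !scalerN -addrA -opprD -scalerDl.
by rewrite -rmorphD /= -dotDr (addrC b) subrr.
Qed.

(** The target of a double bracket of root vectors is governed by the three
    scalar products alone. *)
Lemma gbr_eee a b d : a \in Phi -> b \in Phi -> d \in Phi ->
  br (e_ a) (br (e_ b) (e_ d)) =
  if <|b, d|> == -2 then - (e_ a *~ (eps b d * <|b, a|>))
  else if <|b, d|> == -1 then
    let s := eps b d * eps a (b + d) in
    if <|a, b|> + <|a, d|> == -2 then hc a *~ s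
    else if <|a, b|> + <|a, d|> == -1 then e_ (a + b + d) *~ s else 0
  else 0.
Proof.
move=> Pa Pb Pd; have [[Qa Qb] Qd] := (PhiQ Pa, PhiQ Pb, PhiQ Pd).
rewrite [in LHS]gbr_ee //; case: eqP => [_|_].
  by rewrite gbrMzr gbr_e_ghc // mulNrz -mulrzA mulrC.
case: eqP => [bd|_]; last by rewrite linear0.
have Pbd : b + d \in Phi.
  by rewrite add_in // bd.
rewrite gbrMzr gbr_ee // dzDr //=.
case: eqP => _; first by rewrite -mulrzA mulrC.
by case: eqP => _; [rewrite -mulrzA mulrC addrA|rewrite mul0rz].
Qed.

(** One rotation of (a, b, d) changes the sign of the double bracket by a
    commutator; this is where the cocycle identity enters. *)
Lemma eps_rotate a b d : Q a -> Q b -> Q d ->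
  eps d a * eps b (d + a) =
  eps b d * eps a (b + d) * (-1) ^ (<|a, b|> + <|a, d|>).
Proof.
move=> Qa Qb Qd; rewrite -eps_cocycle //.
rewrite (@eps_swap a (b + d)) //; last exact: simple_latticeD.
by rewrite dzDr // mulrA.
Qed.

(** With two opposite roots, one double bracket passes through the co-root of b
    and is a multiple of e_a by <a, b>. It is cancelled by the path through
    b - a if <a, b> = 1, through b + a if <a, b> = -1, and through a second
    co-root if a = b or a = - b. *)
Lemma jacobiator_opposite a b : a \in Phi -> b \in Phi ->
  jacobiator (e_ a) (e_ b) (e_ (- b)) = 0.
Proof.
move=> Pa Pb; have Pb' := opp_root Phi_roots dot_normalised Pb.
have [[Qa Qb] Qb'] := (PhiQ Pa, PhiQ Pb, PhiQ Pb').
rewrite /jacobiator !gbr_eee // /=.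
rewrite !dzNl //.
rewrite !dzNr //.
rewrite (dotz_root dot_normalised) // (dotzC dot b a) eqxx.
have /andP[ge2 le2] := root_ge Pa Pb.
(* the three coefficients that occur agree with eps b (- b) up to sign *)
have e1 : eps (- b) a * eps b (- b + a) = eps b (- b).
  by rewrite -[RHS]mulr1 -(eps0l Qa) -(subrr b) eps_cocycle.
have e3 : eps a b * eps (- b) (a + b) = eps b (- b) * (-1) ^ <|a, b|>.
  rewrite (eps_rotate Qb Qb' Qa) e1 expN1zD dzNr //.
  rewrite (dotz_root dot_normalised) //.
  by rewrite expN1zN2 mul1r (dotzC dot b a).
have e2 : eps (- b) b = eps b (- b).
  rewrite (@eps_swap b (- b)) //.
  by rewrite dzNr // (dotz_root dot_normalised) // expN1zN2 mulr1.
have [ab|n2] := eqVneq <|a, b|> 2.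
  have : a + - b == 0.
    by rewrite add_eq0 // dzNr // ab.
  rewrite subr_eq0 => /eqP aE.
  by rewrite ab /= aE e2 addr0 -opprD -mulrzDr -mulrDr addrN mulr0 mulr0z oppr0.
have [ab|nN2] := eqVneq <|a, b|> (-2).
  have : a + b == 0 by rewrite add_eq0 // ab.
  rewrite addr_eq0 => /eqP aE.
  rewrite ab /= aE e2 addr0 -opprD -mulrzDr -mulrDr addrN.
  by rewrite mulr0 mulr0z oppr0.
have [ab|n1] := eqVneq <|a, b|> 1.
  by rewrite ab /= e1 subrr add0r addr0 mulr1 addNr.
have [ab|nN1] := eqVneq <|a, b|> (-1).
  rewrite ab /= e3 ab expN1zN1 mulrN1 mulrNz opprK addr0.
  by rewrite addrAC addNr add0r mulrNz subrr.
have -> : <|a, b|> = 0 by lia.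
by rewrite /= mulr0 mulr0z oppr0 !addr0.
Qed.

(** When no two of the roots are opposite, a double bracket can only be nonzero
    if all three scalar products are -1, and then a + b + d = 0, or if two are
    -1 and the third is 0, and then exactly two double brackets survive. *)
Lemma jacobiator_eee a b d : a \in Phi -> b \in Phi -> d \in Phi ->
  jacobiator (e_ a) (e_ b) (e_ d) = 0.
Proof.
move=> Pa Pb Pd; have [[Qa Qb] Qd] := (PhiQ Pa, PhiQ Pb, PhiQ Pd).
have opp u v : u \in Phi -> v \in Phi -> <|u, v|> = -2 -> v = - u.
  move=> Pu Pv uv; have : u + v == 0 by rewrite add_eq0 // uv.
  by rewrite addrC addr_eq0 => /eqP.
have [/opp-> //|ab] := eqVneq <|a, b|> (-2).
  by rewrite 2!jacobiatorC jacobiator_opposite.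
have [/opp-> //|bd] := eqVneq <|b, d|> (-2).
  exact: jacobiator_opposite.
have [/opp-> //|da] := eqVneq <|d, a|> (-2).
  by rewrite jacobiatorC jacobiator_opposite.
have rot1 := eps_rotate Qa Qb Qd; have rot2 := eps_rotate Qb Qd Qa.
have /andP[ab1 ab2] := root_ge Pa Pb.
have /andP[bd1 bd2] := root_ge Pb Pd.
have /andP[da1 da2] := root_ge Pd Pa.
rewrite /jacobiator !gbr_eee // /= rot2 rot1.
rewrite (dotzC dot b a) (dotzC dot d b) (dotzC dot a d).
rewrite (negPf ab) (negPf bd) (negPf da).
set s := eps b d * _.
have sum0 : <|a, b|> = -1 -> <|b, d|> = -1 -> <|d, a|> = -1 ->
    hc a + hc b + hc d = 0.
  move=> abE bdE daE; have Pab : a + b \in Phi by rewrite add_in // abE.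
  rewrite -!ghcD //; last exact: PhiQ.
  have /eqP-> : a + b + d == 0 by rewrite add_eq0 // dzDl // bdE dotzC daE.
  exact: ghc0.
rewrite (addrAC d a) -(addrA a) (addrC d b) (addrC (b + d) a).
have [xE|xn] := eqVneq <|a, b|> (-1); have [yE|yn] := eqVneq <|b, d|> (-1);
  have [zE|zn] := eqVneq <|d, a|> (-1); rewrite ?addr0 ?add0r //.
- by rewrite xE yE zE /= expN1zN2 !mulr1 -!mulrzDl sum0 // mul0rz.
- rewrite xE yE; case: eqP => [|_]; first by lia.
  case: eqP => [z0|z0].
    have -> : <|d, a|> = 0 by lia.
    by rewrite /= addr0 expN1zN1 expN1zN2 mulr1 mulrN1 mulrNz subrr.
  by rewrite add0r; do 2! (case: eqP => [|_]; first by lia).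
- rewrite xE zE; case: eqP => [|_]; first by lia.
  case: eqP => [y0|y0].
    have -> : <|b, d|> = 0 by lia.
    by rewrite /= !add0r expN1zN1 expN1zN2 mulr1 mulrN1 mulrNz subrr.
  by rewrite add0r; do 2! (case: eqP => [|_]; first by lia).
- by do 2! (case: eqP => [|_]; first by lia).
- rewrite yE zE; case: eqP => [|_]; first by lia.
  case: eqP => [x0|x0].
    have -> : <|a, b|> = 0 by lia.
    by rewrite /= !add0r expN1zN1 mulrN1 mulrNz subrr.
  by rewrite add0r; do 2! (case: eqP => [|_]; first by lia).
- by do 2! (case: eqP => [|_]; first by lia).
- by do 2! (case: eqP => [|_]; first by lia).
Qed.

Lemma gbr_lie_algebra : lie_algebra br.
Proof.
split; [exact: gbr_linearl | exact: gbr_linearr | move=> x | ].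
  have /eqP := gbr_antisym x x.
  by rewrite -addr_eq0 -mulr2n -scaler_nat scaler_eq0 pnatr_eq0 => /eqP.
suff J x y z : jacobiator x y z = 0 by [].
move: x; apply: linear_eq0_basis => [|k]; first exact: jacobiator_linear.
rewrite jacobiatorC; move: y; apply: linear_eq0_basis => [|l].
  exact: jacobiator_linear.
rewrite jacobiatorC; move: z; apply: linear_eq0_basis => [|m].
  exact: jacobiator_linear.
case: k l m => [i|a] [j|b] [k|d] /=.
- exact: jacobiator_hhh.
- by rewrite jacobiatorC jacobiator_hhe.
- exact: jacobiator_hhe.
- by rewrite jacobiatorC jacobiator_hee //; exact: fsvalP.
- by rewrite 2!jacobiatorC jacobiator_hhe.
- by rewrite 2!jacobiatorC jacobiator_hee //; exact: fsvalP.
- by rewrite jacobiator_hee //; exact: fsvalP.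
- by apply: jacobiator_eee; exact: fsvalP.
Qed.

(** * Simplicity *)

Lemma weight_of_lattice (k : I + Phi) : Q (weight_of k).
Proof.
case: k => [i|a] /=; first exact: simple_lattice0.
by apply: PhiQ; exact: fsvalP.
Qed.

Lemma dot_simple_separates x y : Q x -> Q y -> x != y ->
  exists i, dot (alpha i) x != dot (alpha i) y.
Proof.
move=> Qx Qy xy; apply: contrapT => nex; case/eqP: xy.
apply/eqP; rewrite -subr_eq0; apply/eqP.
apply: (lattice_nondegenerate (dot := dot) alpha_simple) => [|i].
  by apply: simple_latticeD => //; exact: simple_latticeN.
rewrite dotDr dotNr; apply/eqP; rewrite subr_eq0; apply: contrapT => /negP ne.
by apply: nex; exists i.
Qed.

Lemma ge_neq0 a : a \in Phi -> e_ a != 0.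
Proof.
move=> Pa; apply/eqP => /ffunP/(_ (inr [` Pa]%fset)).
by rewrite !ffunE eqxx => /eqP; rewrite oner_eq0.
Qed.

(** Induction on the number of nonzero coordinates of x: if x has another one,
    at k, some h_i takes different values on the weights of k and a, and
    subtracting from ad h_i its value at k kills the coordinate k without
    killing that of a. *)
Lemma ideal_root_vector (U : {vspace g}) : lie_ideal br U ->
  forall (x : g) a, x \in U -> x (inr a) != 0 -> e_ (val a) \in U.
Proof.
move=> idU x a; have [n] := ubnP #|[set k | x k != 0]|.
elim: n x => // n IH x; rewrite ltnS => card_x xU xa.
have [/forallP k0|] := boolP [forall k, (k != inr a) ==> (x k == 0)].
  have -> : e_ (val a) = (x (inr a))^-1 *: x.
    apply/ffunP => k; rewrite galgZE (gbasisE (inr a) k).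
    have [<-|ak] := eqVneq; first by rewrite mulVf.
    by have := k0 k; rewrite eq_sym ak => /eqP->; rewrite mulr0.
  exact: memvZ.
rewrite negb_forall => /existsP[k]; rewrite negb_imply => /andP[ka xk].
have [i ki] : exists i, dot (alpha i) (weight_of k) != dot (alpha i) (val a).
  apply: dot_simple_separates; try exact: weight_of_lattice.
    exact: (weight_of_lattice (inr a)).
  case: (k) ka => [j|b] /= ka; last by apply: contraNneq ka => /val_inj->.
  by rewrite eq_sym; apply: (root_neq0 Phi_roots); exact: fsvalP.
pose y := br (h_ i) x + (- dot (alpha i) (weight_of k))%:C%C *: x.
have yE l : y l =
    (dot (alpha i) (weight_of l) - dot (alpha i) (weight_of k))%:C%C * x l.
  rewrite /y ffunE galgZE gbr_cartan ?gh_in_cartan // cartan_pairing_gh.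
  by rewrite [in RHS]rmorphD /= mulrDl.
apply: (IH y) => //.
- apply: leq_trans card_x; apply: proper_card; apply/properP; split.
    apply/fintype.subsetP => l; rewrite !inE yE; apply: contraNneq => ->.
    by rewrite mulr0.
  by exists k; rewrite !inE // yE subrr mul0r eqxx.
- by apply: memvD; [exact: idU | exact: memvZ].
- rewrite yE mulf_neq0 // (inj_eq (@complexI R) _ 0) subr_eq0 eq_sym //.
Qed.

(** The real and imaginary parts of the coordinates of h are coefficients of
    combinations of simple roots, to which the nondegeneracy over the reals
    applies. *)
Lemma cartan_pairing_neq0 h : h \in H -> h != 0 ->
  exists j, cartan_pairing h (alpha j) != 0.
Proof.
move=> Hh h0; apply: contrapT => nex; case/eqP: h0.
have {nex} p0 j : cartan_pairing h (alpha j) = 0.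
  by apply/eqP; apply: contrapT => /negP ?; apply: nex; exists j.
have part0 (p : C -> R) : {morph p : u v / u + v} ->
    (forall (r : R) z, p (r%:C%C * z) = r * p z) -> forall i, p (h (inl i)) = 0.
  move=> pD pZ; apply: (simple_roots_nondegenerate (dot := dot) alpha_simple).
  have p00 : p 0 = 0 by have := pZ 0 0; rewrite mulr0 mul0r.
  move=> j; rewrite dot_sumr -[RHS]p00 -(p0 j) (big_morph p pD p00).
  by apply: eq_bigr => i _; rewrite dotZr pZ mulrC dotC.
have h00 i : h (inl i) = 0.
  apply/eqP; rewrite eq_complex (part0 (@complex.Re R)).
    rewrite (part0 (@complex.Im R)) ?eqxx //.
  - by move=> [x y] [z t].
  - by move=> r [x y] /=; rewrite mul0r addr0.
  - by move=> [x y] [z t].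
  - by move=> r [x y] /=; rewrite mul0r subr0.
by rewrite (gcartan_expansion Hh) big1 // => i _; rewrite h00 scale0r.
Qed.

Lemma ghc_simple i : hc (alpha i) = h_ i.
Proof.
rewrite /ghc (bigD1 i) //= big1 => [|j /negPf ji].
  by rewrite (coefs_simple alpha_simple) eqxx addr0.
by rewrite (coefs_simple alpha_simple) ji mulr0z.
Qed.

Lemma gbr_opposite a : a \in Phi ->
  br (e_ a) (e_ (- a)) = hc a *~ eps a (- a).
Proof.
move=> Pa; rewrite gbr_ee_def // ?subrr ?eqxx //.
exact: (opp_root Phi_roots).
Qed.

Lemma memv_sign (U : {vspace g}) x s :
  is_sign s -> (x *~ s \in U) = (x \in U).
Proof. by case=> ->; rewrite ?mulrNz mulr1z ?memvN. Qed.

(** Up to sign the co-root is the bracket of e_a with e_(- a). *)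
Lemma ideal_coroot (U : {vspace g}) a : lie_ideal br U ->
  a \in Phi -> e_ a \in U -> hc a \in U.
Proof.
move=> idU Pa; have Pa' := opp_root Phi_roots dot_normalised Pa.
move=> /(idU (e_ (- a))); rewrite gbr_antisym gbr_opposite //.
rewrite memvN memv_sign //.
by apply: eps_sign; exact: PhiQ.
Qed.

Hypothesis Phi_irreducible : irreducible_roots dot Phi.

(** The roots whose root vectors lie in an ideal form a union of components:
    such a root brings its co-root, which rescales the root vectors of all
    roots not orthogonal to it. *)
Lemma ideal_full (U : {vspace g}) a : lie_ideal br U ->
  a \in Phi -> e_ a \in U -> U = fullv.
Proof.
move=> idU Pa eaU; pose Psi := [fset b in Phi | e_ b \in U]%fset.
have inPsi b : (b \in Psi) = (b \in Phi) && (e_ b \in U) by rewrite !inE.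
have [||Psi0|PsiE] := Phi_irreducible.2 Psi.
- by apply/fsubsetP => b; rewrite inPsi => /andP[].
- move=> b d; rewrite inPsi inE !inPsi => /andP[Pb ebU] /andP[+ Pd].
  rewrite Pd /= => /negP edU.
  rewrite -dzE; try exact: PhiQ.
  apply/eqP; rewrite intr_eq0; apply: contrapT => /negP bd; apply: edU.
  have := idU (e_ d) _ (ideal_coroot idU Pb ebU).
  rewrite gbr_e_ghc; try exact: PhiQ.
  rewrite memvN -scaler_int => /(memvZ (<|b, d|>%:~R)^-1).
  by rewrite scalerA mulVf ?scale1r // intr_eq0.
- by have := inPsi a; rewrite Psi0 Pa eaU inE.
have inU b : b \in Phi -> e_ b \in U by rewrite -{1}PsiE inPsi => /andP[].
apply/vspaceP => x; rewrite memvf (gbasis_expansion x).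
apply: rpred_sum => -[i|b] _; apply: memvZ => /=.
  rewrite -ghc_simple; have Pi := simple_in alpha_simple i.
  by apply: ideal_coroot => //; exact: inU.
by apply: inU; exact: fsvalP.
Qed.

Lemma gbr_simple : simple_lie_algebra br.
Proof.
split.
- exact: gbr_lie_algebra.
- have [Phi0 _] := Phi_irreducible; have /fset0Pn[a Pa] := Phi0.
  exists (hc a), (e_ a); rewrite gbr_cartan_root ?ghc_in_cartan //.
  rewrite cartan_pairing_ghc; last exact: PhiQ.
  rewrite dot_normalised // scaler_eq0 negb_or ge_neq0 // andbT.
  by rewrite (inj_eq (@complexI R) _ 0) pnatr_eq0.
move=> U idU; have [->|U0] := eqVneq U 0%VS; [by left|right].
have xU := memv_pick U; have x0 : vpick U != 0 by rewrite vpick0.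
move: (vpick U) xU x0 => x xU x0.
have [[a xa]|xH] := pselect (exists a, x (inr a) != 0).
  apply: (ideal_full (a := val a)) => //; first exact: fsvalP.
  exact: ideal_root_vector xa.
have Hx : x \in H.
  apply/gcartanP => a; apply/eqP; apply: contrapT => /negP xa.
  by apply: xH; exists a.
have [j xj] := cartan_pairing_neq0 Hx x0.
have Pj := simple_in alpha_simple j; apply: (ideal_full (a := alpha j)) => //.
have := idU (e_ (alpha j)) _ xU; rewrite gbr_antisym gbr_cartan_root // memvN.
move=> /(memvZ (cartan_pairing x (alpha j))^-1).
by rewrite scalerA mulVf ?scale1r.
Qed.

(** * The Chevalley system *)

Lemma gwtE a (h : subvs_of H) : wt a h = cartan_pairing (vsval h) a.
Proof.
rewrite /gwt; set f := (f in linfun f).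
have lf : linear f.
  move=> k u v; rewrite /f scaler_sumr -big_split; apply: eq_bigr => i _ /=.
  by rewrite ffunE galgZE mulrDr mulrCA.
pose F : {linear subvs_of H -> C^o} :=
  HB.pack f (GRing.isLinear.Build _ _ _ _ f lf).
exact: (lfunE F).
Qed.

Lemma gwtE_in a h : h \in H -> wt a (vsproj H h) = cartan_pairing h a.
Proof. by move=> Hh; rewrite gwtE vsprojK. Qed.

Lemma gweight_spaceP (lam : 'Hom(subvs_of H, C^o)) x :
  x \in weight_space br lam <->
  forall h : subvs_of H, br (vsval h) x = lam h *: x.
Proof.
have mem h : (x \in passmx.leigenspace (linfun (br (vsval h))) (lam h)) =
    (br (vsval h) x == lam h *: x).
  rewrite memv_ker add_lfunE opp_lfunE scale_lfunE id_lfunE subr_eq0.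
  pose F : {linear g -> g} := HB.pack (br (vsval h))
    (GRing.isLinear.Build _ _ _ _ (br (vsval h)) (gbr_linearr _)).
  by congr (_ == _); exact: (lfunE F).
rewrite /weight_space memv_bigcap_seq; split=> [/allP xw h|xw]; last first.
  by apply/allP => h _; rewrite mem; exact/eqP.
rewrite (coord_vbasis (memvf h)) linear_sum linear_sum gbr_suml scaler_suml.
apply: eq_bigr => i _ /=; rewrite !linearZ /= gbrZl -scalerA.
congr (_ *: _); apply/eqP; rewrite -mem xw //.
by rewrite mem_nth ?size_tuple.
Qed.

Lemma gweight_space_root a : a \in Phi -> e_ a \in weight_space br (wt a).
Proof.
by move=> Pa; apply/gweight_spaceP => h; rewrite gwtE gbr_cartan_root ?subvsP.
Qed.

Lemma gbr_weight_vector h a x : h \in H -> x \in weight_space br (wt a) ->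
  br h x = cartan_pairing h a *: x.
Proof.
by move=> Hh /gweight_spaceP/(_ (vsproj H h)); rewrite gwtE !vsprojK.
Qed.

Lemma gcartan_abelian x y : x \in H -> y \in H -> br x y = 0.
Proof.
move=> Hx /gcartanP y0; apply/ffunP => -[i|a]; rewrite gbr_cartan // ffunE.
  by rewrite cartan_pairing0 mul0r.
by rewrite y0 mulr0.
Qed.

(** Being abelian, the subalgebra is nilpotent; it is its own normaliser because
    no root vanishes on all h_i. *)
Lemma gcartan_cartan : cartan_subalgebra br H.
Proof.
split.
- by move=> x y Hx Hy; rewrite gcartan_abelian ?mem0v.
- exists 1%N => /=; apply/eqP; rewrite -subv0; apply/span_subvP => z.
  move=> /allpairsP[[x y] [/= /vbasis_mem Hx /vbasis_mem Hy ->]].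
  by rewrite gcartan_abelian ?mem0v.
- move=> x xn; apply/gcartanP => a; have Pa := fsvalP a.
  have [i ia] : exists i, dot (alpha i) (val a) != dot (alpha i) 0.
    apply: (dot_simple_separates); [exact: PhiQ| |].
      exact: simple_lattice0.
    exact: (root_neq0 Phi_roots).
  rewrite dot0r in ia.
  have /gcartanP/(_ a)/eqP := xn _ (gh_in_cartan i).
  rewrite gbr_antisym -scaleN1r galgZE gbr_cartan ?gh_in_cartan //.
  rewrite cartan_pairing_gh !mulf_eq0 oppr_eq0 oner_eq0 /=.
  by rewrite (inj_eq (@complexI R) _ 0) (negPf ia) => /eqP.
Qed.

Lemma gwt_eq a b : Q a -> Q b -> wt a = wt b -> a = b.
Proof.
move=> Qa Qb ab; apply/eqP; apply: contraT => /(dot_simple_separates Qa Qb).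
case=> i; have := congr1 (fun f : 'Hom(_, _) => f (vsproj H (h_ i))) ab.
rewrite /= !gwtE_in ?gh_in_cartan // !cartan_pairing_gh => /complexI ->.
by rewrite eqxx.
Qed.

Lemma gwtD : {morph wt : a b / a + b}.
Proof.
move=> a b; apply/lfunP => h; rewrite add_lfunE !gwtE -big_split.
by apply: eq_bigr => i _; rewrite /= dotDr rmorphD mulrDl.
Qed.

Lemma gwt0 : wt 0 = 0.
Proof. by apply: (addrI (wt 0)); rewrite -gwtD !addr0. Qed.

(** A nonzero coordinate of a weight vector singles out its weight among those
    of the basis vectors. *)
Lemma gwt_root_system : is_root_system_of br Phi wt.
Proof.
split; first exact: gwtD.
  by move=> a b Pa Pb; apply: gwt_eq; exact: PhiQ.
move=> lam; split=> [[lam0 W0]|[a Pa ->]]; last first.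
  split.
    apply: contra_neq (root_neq0 Phi_roots Pa); rewrite -gwt0.
    by apply: gwt_eq; [exact: PhiQ | exact: simple_lattice0].
  apply: contraNneq (ge_neq0 Pa) => W0.
  by have := gweight_space_root Pa; rewrite W0 memv0.
have /gweight_spaceP := memv_pick (weight_space br lam).
have : vpick (weight_space br lam) != 0 by rewrite vpick0.
move: (vpick _) => x x0 xw.
have [k xk] : exists k, x k != 0.
  apply: contrapT => nex; case/eqP: x0; apply/ffunP => k; rewrite ffunE.
  by apply/eqP; apply: contrapT => /negP ?; apply: nex; exists k.
have lamE : lam = wt (weight_of k).
  apply/lfunP => h; apply: (mulIf xk); rewrite gwtE.
  by rewrite -(gbr_cartan x k (subvsP h)) xw galgZE.
case: k xk lamE => [i|a] /= _ lamE; last by exists (val a); first exact: fsvalP.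
by move: lam0; rewrite lamE gwt0 eqxx.
Qed.

Lemma ghc_coroots : are_coroots br Phi wt hc.
Proof.
move=> a Pa; have Qa := PhiQ Pa.
have Pa' := opp_root Phi_roots dot_normalised Pa.
split.
- rewrite -(memv_sign _ (hc a) (eps_sign Qa (PhiQ Pa'))).
  rewrite -gbr_opposite //.
  apply: memv_lie_prod; try exact: gweight_space_root.
    exact: gbr_linearl.
  exact: gbr_linearr.
- apply/eqP => hc0; have := cartan_pairing_ghc a Qa.
  rewrite hc0 dot_normalised // /cartan_pairing big1 => [/eqP|i _].
    by rewrite eq_sym (inj_eq (@complexI R) _ 0) pnatr_eq0.
  by rewrite ffunE mulr0.
- move=> x xw; rewrite (gbr_weight_vector (ghc_in_cartan _) xw).
  by rewrite cartan_pairing_ghc // dot_normalised // rmorph_nat.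
Qed.

(** Here <a, b> = -1, so that <- a, b> = 1 is nonnegative and no root lies
    beyond b in the direction of - a. *)
Lemma string_q0 a b : a \in Phi -> b \in Phi -> a + b \in Phi ->
  string_q Phi a b = 0%N.
Proof.
move=> Pa Pb; rewrite add_in //.
move=> /eqP ab; have Pa' := opp_root Phi_roots dot_normalised Pa.
rewrite -string_pN (string_add_root alpha_simple Phi_roots dot_normalised) //.
rewrite dzNl; try exact: PhiQ.
by rewrite ab.
Qed.

Lemma gbr_root_vectors a b : a \in Phi -> b \in Phi -> a + b \in Phi ->
  br (e_ a) (e_ b) = (eps a b * (string_q Phi a b).+1%:Z)%:~R *: e_ (a + b).
Proof.
move=> Pa Pb Pab; rewrite gbr_ee_def // Pab string_q0 // mulr1 scaler_int.
by rewrite (negPf (root_neq0 Phi_roots Pab)).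
Qed.

Lemma ge_chevalley_system : chevalley_system Phi br wt e_.
Proof.
split.
- exact: gbr_simple.
- exact: gcartan_cartan.
- exact: gwt_root_system.
- by move=> a Pa; split; [exact: gweight_space_root | exact: ge_neq0].
- move=> a b Pa Pb Pab; exists (eps a b); first by apply: eps_sign; exact: PhiQ.
  exact: gbr_root_vectors.
Qed.

End AlgebraStructure.

Theorem proposition3p8 (R : realType) (E : vectType R) (dot : {dot E for idfun})
    (Phi : {fset E}) (I : finType) (alpha : I -> E) (c : I -> int)
    (Phi_roots : root_system dot Phi)
    (Phi_irreducible : irreducible_roots dot Phi)
    (alpha_simple : simple_roots Phi alpha)
    (Phi_simply_laced : simply_laced dot alpha)
    (dot_normalised : forall a, a \in Phi -> dot a a = 2)
    (c_sign : forall i, is_sign (c i))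
    (c_alternating : forall i j,
        i != j -> cartan_matrix dot alpha i j != 0 -> c i = - c j) :
  let Q := root_lattice Phi in
  let eps := eps0 dot alpha c in
  (forall a b, Q a -> Q b -> is_sign (eps a b)) /\
  (forall a b g, Q a -> Q b -> Q g ->
     eps a b * eps (a + b) g = eps b g * eps a (b + g)) /\
  (forall a, Q a -> eps a 0 = 1 /\ eps 0 a = 1) /\
  (forall a b, Q a -> Q b -> eps a b * eps b a = (-1) ^ dotz dot a b) /\
  simple_lie_algebra (gbr (Phi := Phi) dot alpha eps) /\
  special_chevalley_system Phi alpha (gbr dot alpha eps)
    (gwt dot Phi alpha) (ghc Phi alpha) (@ge R E Phi I) c /\
  (forall a, a \in Phi ->
     eps a a = eps a (- a) /\ eps a (- a) = - (-1) ^ height alpha a).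
Proof.
move=> Q eps.
have QL x : Q x -> simple_lattice alpha x by exact: root_lattice_simple.
have PL x : x \in Phi -> simple_lattice alpha x by exact: root_simple_lattice.
have eps_sign x y : simple_lattice alpha x -> simple_lattice alpha y ->
  is_sign (eps x y) by move=> _ _; exact: eps0_sign.
have eps_l x : simple_lattice alpha x -> eps 0 x = 1.
  by move=> _; exact: (eps00l dot c alpha_simple).
have eps_coc x y z : simple_lattice alpha x -> simple_lattice alpha y ->
    simple_lattice alpha z -> eps x y * eps (x + y) z = eps y z * eps x (y + z).
  exact: (eps0_cocycle dot alpha_simple c_sign).
have eps_comm x y : simple_lattice alpha x -> simple_lattice alpha y ->
    eps x y * eps y x = (-1) ^ dotz dot x y.
  exact: (eps0_commutator alpha_simple Phi_roots dot_normalised).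
have chev := ge_chevalley_system alpha_simple Phi_roots dot_normalised
  eps_sign eps_coc eps_l eps_comm Phi_irreducible.
have Pi i := simple_in alpha_simple i.
have Pi' i := opp_root Phi_roots dot_normalised (Pi i).
have Qi i : simple_lattice alpha (alpha i) by exact: simple_lattice_simple.
have Qi' i := simple_latticeN (Qi i).
have eps_i i x : simple_lattice alpha x ->
    eps (alpha i) x = c i ^ dotz dot (alpha i) x.
  exact: (eps0_simplel alpha_simple Phi_roots dot_normalised c_sign).
have cN1 i : c i ^ (-1) = c i by case: (c_sign i) => ->; [|exact: expN1zN1].
split; first by move=> x y _ _; exact: eps0_sign.
split; first by move=> x y z /QL Qx /QL Qy /QL Qz; exact: eps_coc.
split; first by move=> x _; split;
  [exact: (eps00r dot c alpha_simple) | exact: (eps00l dot c alpha_simple)].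
split; first by move=> x y /QL Qx /QL Qy; exact: eps_comm.
split; first exact: (chev_simple chev).
split; last first.
  move=> a Pa.
  exact: (eps0_root_diagonal alpha_simple Phi_roots dot_normalised).
split=> //.
- exact: (ghc_coroots alpha_simple Phi_roots dot_normalised).
- move=> i; rewrite (gbr_opposite alpha eps Phi_roots dot_normalised) //.
  rewrite eps_i ?(dotzNr alpha_simple Phi_roots dot_normalised) //.
  rewrite (dotz_root dot_normalised) // (_ : - 2 = 2 * - 1) //.
  by rewrite sign_exp2 // mulr1z.
- move=> i a [Pa _]; have Qa := PL a Pa; rewrite addrC => Pia.
  rewrite (gbr_root_vectors eps alpha_simple Phi_roots dot_normalised) //.
  rewrite eps_i //; move: Pia.
  rewrite (add_roots_in alpha_simple Phi_roots dot_normalised) // => /eqP->.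
  by rewrite cN1.
- move=> i a [Pa _]; have Qa := PL a Pa; rewrite addrC => Pia.
  rewrite (gbr_root_vectors eps alpha_simple Phi_roots dot_normalised) //.
  rewrite -string_pN opprK.
  move: Pia; rewrite (add_roots_in alpha_simple Phi_roots dot_normalised) //.
  rewrite (dotzNl alpha_simple Phi_roots dot_normalised) // eqr_opp => /eqP ia.
  have -> : eps (- alpha i) a = eps (alpha i) a.
    exact: (eps0Nl dot alpha_simple c_sign).
  rewrite eps_i // ia expr1z.
  rewrite !(string_add_root alpha_simple Phi_roots dot_normalised) //.
  by rewrite ia.
Qed.
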